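(* Let $x\in\mathbb{C}$ with $\mathrm{Re}(x)>0$, let $k,p$ be positive real numbers, and let $n\in\mathbb{N}$, $n\ge 1$. Then $$\frac{\partial}{\partial k}\left[{}_{p}(x)_{n,k}\right]=-\frac{n}{k}\;{}_{p}(x)_{n,k}+\frac{p}{k}\sum_{s=1}^{n-1}s\;{}_{p}(x)_{s,k}\;{}_{p}(x+(s+1)k)_{n-1-s,k}$$ and $$\frac{\partial}{\partial p}\left[{}_{p}(x)_{n,k}\right]=\frac{n}{p}\;{}_{p}(x)_{n,k}.$$
   Context: The p-k Pochhammer symbol is ${}_{p}(x)_{n,k}=\left(\frac{xp}{k}\right)\left(\frac{xp}{k}+p\right)\left(\frac{xp}{k}+2p\right)\cdots\left(\frac{xp}{k}+(n-1)p\right)$ for $n\ge1$, and ${}_{p}(x)_{0,k}=1$ (empty product). *)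

(* Defs.v *)
From Stdlib Require Import Reals.
From Coquelicot Require Import Coquelicot.

Open Scope C_scope.

Fixpoint pk_pochhammer (p : R) (x : C) (n : nat) (k : R) : C :=
  match n with
  | O => 1
  | S m => pk_pochhammer p x m k * (x * p / k + INR m * p)
  end.

(* Derivative of a complex-valued function of a real variable: C is taken as a
   normed space over R, not over itself. *)
Definition is_derive_RC (f : R -> C) (t : R) (l : C) : Prop :=
  @is_derive R_AbsRing C_R_NormedModule f t l.

(* Main.v *)
(* The i-th factor a_i = x p / k + i p satisfies da_i/dk = - (a_i - i p) / k and
   da_i/dp = a_i / p, so both formulas are the Leibniz rule for the product of
   a_0, ..., a_(n-1), obtained by induction on n.  The cofactor of a_s splits as
   the symbol of length s at x times the symbol of length n - 1 - s at
   x + (s + 1) k. *)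
Require Import Defs.
From Stdlib Require Import Reals Lra Lia.
From Coquelicot Require Import Coquelicot.

Local Open Scope C_scope.

(** Reduces complex values to real calculus. Forwards, compose with the linear projections;
    backwards, write [z] as [Re z] times (1, 0) plus [Im z] times (0, 1), two constant vectors. *)
Lemma is_derive_RC_components (f : R -> C) (t : R) (l : C) :
  is_derive_RC f t l <->
  is_derive (fun u => Re (f u)) t (Re l) /\ is_derive (fun u => Im (f u)) t (Im l).
Proof.
split.
- intros H; split.
  + eapply filterdiff_ext_lin.
    * apply (filterdiff_comp f (fun z : R * R => fst z) _ (fun z => fst z) H).
      apply filterdiff_linear, is_linear_fst.
    * reflexivity.
  + eapply filterdiff_ext_lin.
    * apply (filterdiff_comp f (fun z : R * R => snd z) _ (fun z => snd z) H).
      apply filterdiff_linear, is_linear_snd.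
    * reflexivity.
- intros [Hre Him].
  assert (decomp : forall z : C, z = plus (@scal _ C_R_NormedModule (Re z) (1, 0)%R)
                                 (@scal _ C_R_NormedModule (Im z) (0, 1)%R)).
  { intros [a b]; unfold Re, Im; simpl.
    apply injective_projections; cbn; unfold mult; simpl; ring. }
  rewrite (decomp l).
  eapply is_derive_ext; [intro u; symmetry; apply decomp|].
  apply (is_derive_plus (V := C_R_NormedModule));
    apply (is_derive_scal_l (V := C_R_NormedModule)); assumption.
Qed.

Lemma is_derive_RC_mult (f g : R -> C) (t : R) (f' g' : C) :
  is_derive_RC f t f' -> is_derive_RC g t g' ->
  is_derive_RC (fun u => f u * g u) t (f' * g t + f t * g').
Proof.
rewrite !is_derive_RC_components; intros [Hf1 Hf2] [Hg1 Hg2].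
split; cbn.
(* Regroup as the derivative of Re f Re g - Im f Im g, so that the real product rule applies to each
   term. *)
- replace (_ + _)%R with
    (minus (plus (mult (Re f') (Re (g t))) (mult (Re (f t)) (Re g')))
       (plus (mult (Im f') (Im (g t))) (mult (Im (f t)) (Im g'))))
    by (unfold minus, plus, opp, mult, Re, Im; simpl; ring).
  apply (is_derive_minus (K := R_AbsRing) (V := R_NormedModule));
    apply (is_derive_mult (K := R_AbsRing)); auto; exact Rmult_comm.
- replace (_ + _)%R with
    (plus (plus (mult (Re f') (Im (g t))) (mult (Re (f t)) (Im g')))
       (plus (mult (Im f') (Re (g t))) (mult (Im (f t)) (Re g'))))
    by (unfold plus, mult, Re, Im; simpl; ring).
  apply (is_derive_plus (K := R_AbsRing) (V := R_NormedModule));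
    apply (is_derive_mult (K := R_AbsRing)); auto; exact Rmult_comm.
Qed.

Lemma is_derive_factor_k (x : C) (p k : R) (m : nat) : (0 < k)%R ->
  is_derive_RC (fun k' : R => x * p / k' + INR m * p) k (- (x * p / (k * k))).
Proof.
intros Hk; destruct x as [a b]; rewrite is_derive_RC_components.
split; cbn; auto_derive; try nra; field; nra.
Qed.

Lemma is_derive_factor_p (x : C) (p k : R) (m : nat) :
  is_derive_RC (fun p' : R => x * p' / k + INR m * p') p (x / k + INR m).
Proof.
destruct x as [a b]; rewrite is_derive_RC_components.
split; cbn; auto_derive; trivial; unfold Rdiv; ring.
Qed.

(** The shift by (s + 1) k advances the factors by s + 1 places, so the last factor on the left is
    (x + (s + 1) k) p / k + (n - 1 - s) p = x p / k + n p. It does not depend on [s] and can be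
    pulled out of the sum. *)
Lemma pk_pochhammer_succ_tail (p k : R) (x : C) (n s : nat) :
  (0 < k)%R -> (s < n)%nat ->
  pk_pochhammer p (x + INR (s + 1) * k) (n - s) k =
  pk_pochhammer p (x + INR (s + 1) * k) (n - 1 - s) k * (x * p / k + INR n * p).
Proof.
intros Hk Hs.
replace (n - s)%nat with (S (n - 1 - s)) by lia; cbn [pk_pochhammer].
f_equal.
replace (INR n) with (INR (s + 1) + INR (n - 1 - s))%R
  by (rewrite <- plus_INR; f_equal; lia).
rewrite RtoC_plus; field.
intro E; apply RtoC_inj in E; lra.
Qed.

(** In the step from n to n + 1, the new factor a has derivative -a / k + n p / k. The first part
    turns n / k into (n + 1) / k; the second gives the new summand s = n. *)
Lemma is_derive_pk_pochhammer_k (x : C) (k p : R) (n : nat) : (0 < k)%R ->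
  is_derive_RC (fun k' : R => pk_pochhammer p x n k') k
    (- (INR n / k) * pk_pochhammer p x n k
     + p / k * sum_n_m (fun s : nat =>
          INR s * pk_pochhammer p x s k
          * pk_pochhammer p (x + INR (s + 1) * k) (n - 1 - s) k) 1 (n - 1)).
Proof.
intros Hk.
assert (Hk0 : RtoC k <> 0) by (intro E; apply RtoC_inj in E; lra).
induction n as [|n IH].
(* Truncated subtraction makes the range 1 to 0, an empty sum. *)
- simpl sum_n_m; rewrite sum_n_m_zero by lia; simpl.
  replace (_ + _) with (RtoC 0) by (change (@zero _) with (RtoC 0); field; exact Hk0).
  apply (is_derive_const (V := C_R_NormedModule)).
- cbn [pk_pochhammer].
  pose proof (is_derive_RC_mult _ _ _ _ _ IH (is_derive_factor_k x p k n Hk)) as H.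
  eapply eq_ind; [exact H|]; clear H IH.
  set (a := x * p / k + INR n * p).
  replace (S n - 1)%nat with n by lia.
  (* For a single factor both sums are empty; otherwise the new sum has a last term to split off. *)
  destruct n as [|n].
  + rewrite !sum_n_m_zero by lia; change (@zero _) with (RtoC 0).
    unfold a; simpl; field; exact Hk0.
  + rewrite (sum_n_Sm _ 1 n) by lia.
    replace (S n - 1)%nat with n by lia.
    (* Each remaining term is the corresponding term of the old sum times [a]. *)
    rewrite (sum_n_m_ext_loc
      (fun s => INR s * pk_pochhammer p x s k
          * pk_pochhammer p (x + INR (s + 1) * k) (S n - s) k)
      (fun s => mult (INR s * pk_pochhammer p x s k
          * pk_pochhammer p (x + INR (s + 1) * k) (n - s) k) a)).
    2:{ intros s Hs; rewrite pk_pochhammer_succ_tail by (auto; lia).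
        replace (S n - 1 - s)%nat with (n - s)%nat by lia.
        apply Cmult_assoc. }
    rewrite (sum_n_m_mult_r (K := C_Ring)).
    (* In the split-off term the second symbol has length 0, hence equals 1. *)
    replace (S n - S n)%nat with O by lia.
    change (@plus C_AbelianMonoid) with Cplus; change (@mult C_Ring) with Cmult.
    set (S1 := sum_n_m _ _ _).
    unfold a; rewrite (S_INR (S n)), RtoC_plus.
    cbn [pk_pochhammer].
    field; exact Hk0.
Qed.

(** Euler's identity: each factor is linear in [p], so the symbol is homogeneous of degree [n] in
    [p]. *)
Lemma is_derive_pk_pochhammer_p (x : C) (k p : R) (n : nat) :
  (0 < k)%R -> (0 < p)%R ->
  is_derive_RC (fun p' : R => pk_pochhammer p' x n k) p
    (INR n / p * pk_pochhammer p x n k).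
Proof.
intros Hk Hp.
assert (Hk0 : RtoC k <> 0) by (intro E; apply RtoC_inj in E; lra).
assert (Hp0 : RtoC p <> 0) by (intro E; apply RtoC_inj in E; lra).
induction n as [|n IH].
- simpl; replace (0 / p * 1) with (RtoC 0) by (field; exact Hp0).
  apply (is_derive_const (V := C_R_NormedModule)).
- cbn [pk_pochhammer].
  pose proof (is_derive_RC_mult _ _ _ _ _ IH (is_derive_factor_p x p k n)) as H.
  eapply eq_ind; [exact H|].
  rewrite S_INR, RtoC_plus; field; auto.
Qed.

Theorem theorem2p2 :
  forall (x : C) (k p : R) (n : nat),
    (0 < Re x)%R -> (0 < k)%R -> (0 < p)%R -> (1 <= n)%nat ->
    is_derive_RC (fun k' : R => pk_pochhammer p x n k') k
      (- (INR n / k) * pk_pochhammer p x n k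
       + p / k * sum_n_m (fun s : nat =>
            INR s * pk_pochhammer p x s k
            * pk_pochhammer p (x + INR (s + 1) * k) (n - 1 - s) k) 1 (n - 1))%C
    /\
    is_derive_RC (fun p' : R => pk_pochhammer p' x n k) p
      (INR n / p * pk_pochhammer p x n k)%C.
Proof.
intros x k p n _ Hk Hp _; split.
- apply is_derive_pk_pochhammer_k; exact Hk.
- apply is_derive_pk_pochhammer_p; assumption.
Qed.
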